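(* Let $q$ be a prime power, let $P$ be a set of points in $\mathbb{F}_q^3$ and let $\Pi$ be a set of planes in $\mathbb{F}_q^3$, each of the form $\{x\in\mathbb{F}_q^3 : a\cdot x=1\}$ with $a\in\mathbb{F}_q^3$. If $|\Pi|\ge 2q^{1+\alpha}$ for some $\alpha\in(0,1)$, then $$I(P,\Pi)\ll \frac{|P||\Pi|}{q^{\alpha}}+|\Pi|q^{2\alpha}.$$ Symmetrically, if $|P|\ge 2q^{1+\alpha}$ for some $\alpha\in(0,1)$, then $$I(P,\Pi)\ll \frac{|P||\Pi|}{q^{\alpha}}+|P|q^{2\alpha}.$$
   Context: $\mathbb{F}_q$ is the finite field with $q$ elements, $q$ a prime power, and $a\cdot x=a_1x_1+a_2x_2+a_3x_3$ for $a,x\in\mathbb{F}_q^3$. $I(P,\Pi)$ is the number of pairs $(p,\pi)\in P\times\Pi$ with $p\in\pi$. The notation $f\ll g$ means $f=O(g)$, i.e. $f\le Cg$ with an absolute constant $C>0$ (independent of $q$, $\alpha$ and the sets). *)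

(* Defs.v *)
From HB Require Import structures.
From mathcomp Require Import all_boot all_order all_algebra.
Set Implicit Arguments.
Unset Strict Implicit.
Unset Printing Implicit Defensive.
Import GRing.Theory.
Local Open Scope ring_scope.

Definition dot3 (F : finFieldType) (a x : 'rV[F]_3) : F :=
  \sum_(i < 3) a 0 i * x 0 i.

Definition hyperplane3 (F : finFieldType) (a : 'rV[F]_3) (b : F) :
    {set 'rV[F]_3} :=
  [set x | dot3 a x == b].

(* The normal vector must be nonzero: [hyperplane3 0 b] is empty or the whole
   space. *)
Definition is_plane (F : finFieldType) (pi : {set 'rV[F]_3}) : Prop :=
  exists a b, a != 0 /\ pi = hyperplane3 a b.

Definition incidences (F : finFieldType) (P : {set 'rV[F]_3})
    (Pi : {set {set 'rV[F]_3}}) : nat :=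
  #|[set u in setX P Pi | u.1 \in u.2]|.

(* Main.v *)
(** A plane [a.x = 1] is determined by [a], so incidences form the symmetric
    relation [a.x = 1] between two subsets of F^3.  Write s = q^alpha, m = |A|
    for the points and N = |B| >= 2qs for the normals.

    If s^2 >= q, the variance over all of F^3 of the number of planes through a
    point gives (qI - mN)^2 <= q^4 mN, and AM-GM concludes.

    If s^2 <= q, only planes with more than T = 2(m/s + s^2) points of A matter.
    Such a plane with t points either has no line carrying more than t/2 of
    them, and then contains at least t^3/4 non-collinear triples, each of which
    determines its plane, so that the sum of these t is at most 4m^3/T^2; or it
    contains a line with more than T/2 points of A.  Since T^2 >= 8m, the point
    counts of all such lines add up to at most 2m, and at most q planes of the
    form [a.x = 1] contain a given line. *)

Require Import Defs.
From HB Require Import structures.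
From mathcomp Require Import all_boot all_order all_algebra.
From mathcomp Require Import mxabelem.
From mathcomp Require Import reals exp.
From mathcomp Require Import ring lra zify.
Set Implicit Arguments.
Unset Strict Implicit.
Unset Printing Implicit Defensive.
Import Order.TTheory GRing.Theory Num.Theory.
Local Open Scope ring_scope.

(** * Planes [a.x = 1] and lines in F^3 *)

Section AffineSpace.
Variable F : finFieldType.
Implicit Types (a b x y z w : 'rV[F]_3).

Lemma dot3C a x : dot3 a x = dot3 x a.
Proof. by apply: eq_bigr => i _; rewrite mulrC. Qed.

Lemma dot3E a x : dot3 a x = (x *m a^T) 0 0.
Proof. by rewrite mxE dot3C; apply: eq_bigr => i _; rewrite mxE. Qed.

Lemma dot3_eq a x w : (x *m a^T == w *m a^T) = (dot3 a x == dot3 a w).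
Proof.
rewrite !dot3E; apply/eqP/eqP => [-> // | h].
by apply/matrixP=> i j; rewrite !ord1.
Qed.

Lemma dot3_line a x y (t : F) :
  dot3 a (x + t *: (y - x)) = dot3 a x + t * (dot3 a y - dot3 a x).
Proof.
by rewrite !dot3E mulmxDl -scalemxAl mulmxBl !mxE.
Qed.

Lemma dot3_surj a (c : F) : a != 0 -> exists w, dot3 a w = c.
Proof.
move=> a0; have [i ai] : exists i, a 0 i != 0.
  apply/existsP; apply: contraR a0; rewrite negb_exists => /forallP h.
  by apply/eqP/rowP => i; rewrite mxE; move: (h i); rewrite negbK => /eqP.
exists ((c / a 0 i) *: delta_mx 0 i).
rewrite /dot3 (bigD1 i) //= !mxE !eqxx mulr1 mulrC divfK // big1 ?addr0 //.
move=> j ji.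
by rewrite !mxE (negbTE ji) andbF !mulr0.
Qed.

(** The fiber through [w0] is the translate by [w0] of the kernel of [M]. *)
Lemma card_mulmx_fiber n k (M : 'M[F]_(n, k)) (w0 : 'rV[F]_n) :
  #|[set w | w *m M == w0 *m M]| = (#|F| ^ (n - \rank M))%N.
Proof.
rewrite -mxrank_ker -card_rowg -[RHS](card_imset _ (addrI w0)).
apply: eq_card => w; rewrite inE; apply/idP/imsetP.
- move=> /eqP h; exists (w - w0); last by rewrite addrC subrK.
  by rewrite mem_rowg; apply/sub_kermxP; rewrite mulmxBl h subrr.
- case=> u; rewrite mem_rowg => /sub_kermxP hu ->.
  by rewrite mulmxDl hu addr0.
Qed.

Lemma card_hyperplane3 a : a != 0 -> #|hyperplane3 a 1| = (#|F| ^ 2)%N.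
Proof.
move=> a0; have [w0 w0a] := dot3_surj 1 a0.
have -> : hyperplane3 a 1 = [set w | w *m a^T == w0 *m a^T].
  by apply/setP=> w; rewrite !inE dot3_eq w0a.
by rewrite card_mulmx_fiber mxrank_tr rank_rV a0.
Qed.

(** Given a common point [w0], pairing a dependence l a + r b = 0 with [w0] yields l + r = 0, hence
    r (b - a) = 0 and r = l = 0. So [a] and [b] are independent, and the intersection is a fiber of
    a map of rank 2. *)
Lemma card_hyperplane3_setI a b : a != b ->
  (#|hyperplane3 a 1%R :&: hyperplane3 b 1%R| <= #|F|)%N.
Proof.
move=> ab; have [->|[w0]] := set_0Vmem (hyperplane3 a 1 :&: hyperplane3 b 1).
  by rewrite cards0.
rewrite !inE => /andP[/eqP a1 /eqP b1].
have -> : hyperplane3 a 1 :&: hyperplane3 b 1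
    = [set w | w *m (col_mx a b)^T == w0 *m (col_mx a b)^T].
  apply/setP=> w; rewrite !inE tr_col_mx !mul_mx_row.
  rewrite -[X in (_ == X) && _]a1 -[X in _ && (_ == X)]b1 -!dot3_eq.
  apply/andP/eqP => [[/eqP-> /eqP->] //|].
  by case/eq_row_mx => -> ->.
rewrite card_mulmx_fiber mxrank_tr.
suff /eqP -> : row_free (col_mx a b) by rewrite expn1.
apply: inj_row_free => v; rewrite -(hsubmxK v) mul_row_col.
set l := lsubmx v; set r := rsubmx v => lr0.
have E (u : 'rV[F]_1) c : dot3 c w0 = 1 -> u *m c *m w0^T = u.
  move=> h; rewrite -mulmxA; suff -> : c *m w0^T = 1%:M by rewrite mulmx1.
  by apply/matrixP => i j; rewrite !ord1 -dot3E dot3C h mxE.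
have lr : l + r = 0 by rewrite -(E l a a1) -(E r b b1) -mulmxDl lr0 mul0mx.
have lE : l = - r by apply/eqP; rewrite -addr_eq0 lr.
move: lr0; rewrite lE mulNmx addrC -mulmxBr (mx11_scalar r) mul_scalar_mx.
move/eqP; rewrite scaler_eq0 subr_eq0 (eq_sym b) (negbTE ab) orbF => /eqP ->.
by rewrite raddf0 oppr0 row_mx0.
Qed.

(** A line is represented by two of its points; for x = y it degenerates to the single point x. *)
Definition line3 x y : {set 'rV[F]_3} := [set x + t *: (y - x) | t in [set: F]].

Lemma card_line3 x y : x != y -> #|line3 x y| = #|F|.
Proof.
move=> xy; rewrite card_imset ?cardsT // => t u /addrI /eqP.
rewrite -subr_eq0 -scalerBl scaler_eq0 !subr_eq0 => /orP[/eqP //|].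
by rewrite eq_sym (negbTE xy).
Qed.

Lemma line3_sub_hyperplane x y a :
  x \in hyperplane3 a 1 -> y \in hyperplane3 a 1 ->
  line3 x y \subset hyperplane3 a 1.
Proof.
rewrite !inE => /eqP ax /eqP ay; apply/subsetP => _ /imsetP[t _ ->].
by rewrite inE dot3_line ax ay subrr mulr0 addr0.
Qed.

Lemma line3_eq x y u v : x != y -> u != v ->
  u \in line3 x y -> v \in line3 x y -> line3 u v = line3 x y.
Proof.
move=> xy uv /imsetP[s _ us] /imsetP[t _ vt].
apply/eqP; rewrite eqEcard !card_line3 // leqnn andbT.
apply/subsetP => _ /imsetP[r _ ->]; apply/imsetP; exists (s + r * (t - s)) => //.
rewrite us vt opprD addrACA subrr add0r -scalerBl scalerA -addrA -scalerDl.
by [].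
Qed.

Lemma hyperplane3_setI_line x y a b : x != y -> a != b ->
  x \in hyperplane3 a 1 :&: hyperplane3 b 1 ->
  y \in hyperplane3 a 1 :&: hyperplane3 b 1 ->
  hyperplane3 a 1 :&: hyperplane3 b 1 = line3 x y.
Proof.
move=> xy ab; rewrite !(in_setI x) !(in_setI y) => /andP[xa xb] /andP[ya yb].
apply/esym/eqP; rewrite eqEcard card_line3 // card_hyperplane3_setI // andbT.
by rewrite subsetI !line3_sub_hyperplane.
Qed.

(** By duality, the normals of planes through [x] and [y] are the common points of the planes with
    normals [x] and [y]. *)
Lemma card_hyperplanes_through x y : x != y ->
  (#|[set a | (x \in hyperplane3 a 1%R) && (y \in hyperplane3 a 1%R)]|
    <= #|F|)%N.
Proof.
move=> xy; apply: leq_trans (card_hyperplane3_setI xy); apply: subset_leq_card.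
by apply/subsetP => a; rewrite !inE !(dot3C a).
Qed.

(** Distinct normals would force q^2 <= q, as the plane would equal its intersection with the other
    one. *)
Lemma hyperplane3_inj a b : a != 0 -> hyperplane3 a 1 = hyperplane3 b 1 -> a = b.
Proof.
move=> a0 ab; apply/eqP; apply: contraT => /card_hyperplane3_setI.
rewrite -ab setIid card_hyperplane3 // -[X in (_ <= X)%N]expn1.
by rewrite leq_exp2l // card_finNzRing_gt1.
Qed.

End AffineSpace.

(** * Double counting and second moments *)

Section DoubleCounting.
Variables (T U : finType).
Implicit Types (A : {set T}) (B : {set U}) (S : U -> {set T}).

Lemma cardsI_sum A (E : {set T}) : #|A :&: E| = (\sum_(x in A) (x \in E))%N.
Proof.
rewrite -sum1_card (eq_bigl _ _ (fun x => in_setI x A E)) big_mkcondr.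
by apply: eq_bigr => x _; case: ifP.
Qed.

Lemma sum_cardsI A B S :
  (\sum_(b in B) #|A :&: S b| = \sum_(x in A) #|[set b in B | x \in S b]|)%N.
Proof.
under eq_bigr do rewrite cardsI_sum.
rewrite exchange_big; apply: eq_bigr => x _.
rewrite -sum1_card; under [RHS]eq_bigl => b do rewrite inE.
by rewrite [RHS]big_mkcondr; apply: eq_bigr => b _; case: ifP.
Qed.

(** The sum of squares counts triples (x, b, b') with x in both [S b] and [S b']: the diagonal b =
    b' gives the first term, and each other pair contributes at most [k]. *)
Lemma sum_sqr_le A B S k :
  (forall b b', b \in B -> b' \in B -> b != b' ->
     (#|A :&: S b :&: S b'| <= k)%N) ->
  (\sum_(x in A) #|[set b in B | x \in S b]| ^ 2
     <= \sum_(b in B) #|A :&: S b| + k * #|B| ^ 2)%N.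
Proof.
move=> hk.
have -> : (\sum_(x in A) #|[set b in B | x \in S b]| ^ 2
    = \sum_(b in B) \sum_(b' in B) #|A :&: S b :&: S b'|)%N.
  transitivity (\sum_(b in B)
      \sum_(x in A :&: S b) #|[set b' in B | x \in S b']|)%N; last first.
    by apply: eq_bigr => b _; rewrite sum_cardsI.
  under [RHS]eq_bigr => b _ do
    rewrite (eq_bigl _ _ (fun x => in_setI x A (S b))) big_mkcondr.
  rewrite exchange_big; apply: eq_bigr => x _.
  rewrite -mulnn -sum_nat_const; under eq_bigl => b do rewrite inE.
  by rewrite big_mkcondr.
have -> : (k * #|B| ^ 2 = \sum_(b in B) k * #|B|)%N.
  by rewrite sum_nat_const mulnCA mulnn.
rewrite -big_split; apply: leq_sum => b bB.
rewrite (bigD1 b) //= -setIA setIid leq_add2l.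
apply: (@leq_trans (\sum_(b' in B | b' != b) k)).
  by apply: leq_sum => b' /andP[b'B b'b]; rewrite hk // eq_sym.
rewrite big_mkcondr mulnC -sum_nat_const.
by apply: leq_sum => b' _; case: ifP.
Qed.

End DoubleCounting.

(** Cauchy-Schwarz, read off from the nonnegative sum of (m f(x) - S)^2, where S is the sum of f
    over A and m = |A|. *)
Lemma sqr_sum_le (R : realFieldType) (T : finType) (A : {set T}) (f : T -> R) :
  (\sum_(x in A) f x) ^+ 2 <= #|A|%:R * \sum_(x in A) f x ^+ 2.
Proof.
have [->|A0] := eqVneq A set0; first by rewrite !big_set0 expr0n cards0 mul0r.
set S := \sum_(x in A) f x; set m : R := #|A|%:R.
have m0 : 0 < m by rewrite ltr0n card_gt0.
have : 0 <= \sum_(x in A) (m * f x - S) ^+ 2 by apply: sumr_ge0 => x _; apply: sqr_ge0.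
have -> : \sum_(x in A) (m * f x - S) ^+ 2
    = m * (m * (\sum_(x in A) f x ^+ 2) - S ^+ 2).
  under eq_bigr => x _.
    have -> : (m * f x - S) ^+ 2 = m ^+ 2 * f x ^+ 2 - 2 * m * S * f x + S ^+ 2 by ring.
    over.
  rewrite big_split sumrB -!mulr_sumr sumr_const -[_ *+ #|_|]mulr_natl -/m -/S /=; ring.
by rewrite pmulr_rge0 // subr_ge0.
Qed.

(** * Incidences between points and normals; the variance bound *)

Section Incidences.
Variable F : finFieldType.
Local Notation V := 'rV[F]_3.
Local Notation H b := (hyperplane3 b 1%R).
Implicit Types (A B D E : {set V}).

(** Planes are replaced by their normals, so that both arguments are subsets of F^3 and may be
    exchanged. *)
Definition inc A B : nat := (\sum_(b in B) #|A :&: H b|)%N.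

Lemma incC A B : inc A B = inc B A.
Proof.
rewrite /inc sum_cardsI; apply: eq_bigr => x _; apply: eq_card => b.
by rewrite !inE dot3C.
Qed.

(** With r(x) the number of planes through x, the left side is the square of the sum over [A] of q
    r(x) - N. After Cauchy-Schwarz the sum of squares is extended to all of F^3, where both moments
    of r are under control. Since 0 is not in [B], each plane has exactly q^2 points. *)
Lemma inc_variance (R : realFieldType) A B : 0 \notin B ->
  (#|F|%:R * (inc A B)%:R - #|A|%:R * #|B|%:R) ^+ 2
    <= #|F|%:R ^+ 4 * #|A|%:R * #|B|%:R :> R.
Proof.
move=> B0; set q : R := #|F|%:R; set m : R := #|A|%:R; set N : R := #|B|%:R.
pose r x : nat := #|[set b in B | x \in H b]|.
have q0 : 0 <= q by rewrite ler0n.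
have Ir : (inc A B)%:R = \sum_(x in A) (r x)%:R :> R.
  by rewrite /inc sum_cardsI natr_sum.
have cardH b : b \in B -> #|H b| = (#|F| ^ 2)%N.
  by move=> bB; apply: card_hyperplane3; apply: contraNneq B0 => <-.
have sumT : (\sum_(b in B) #|setT :&: H b| = #|B| * #|F| ^ 2)%N.
  rewrite -sum_nat_const; apply: eq_bigr => b bB.
  by rewrite setTI cardH.
have r1 : \sum_(x in [set: V]) (r x)%:R = N * q ^+ 2.
  by rewrite -natr_sum -sum_cardsI sumT natrM natrX.
have r2 : \sum_(x in [set: V]) (r x)%:R ^+ 2 <= N * q ^+ 2 + q * N ^+ 2.
  have := @sum_sqr_le _ _ [set: V] B (fun b => H b) #|F|.
  rewrite sumT => h; have {h} : (\sum_(x in [set: V]) r x ^ 2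
      <= #|B| * #|F| ^ 2 + #|F| * #|B| ^ 2)%N.
    by apply: h => b b' _ _ bb'; rewrite setTI card_hyperplane3_setI.
  rewrite -(ler_nat R) natrD [(#|B| * _)%:R]natrM [(#|F| * _)%:R]natrM !natrX.
  rewrite natr_sum; apply: le_trans.
  by apply: ler_sum => x _; rewrite natrX.
have cT : #|[set: V]|%:R = q ^+ 3 by rewrite cardsT card_mx mul1n natrX.
have -> : q * (inc A B)%:R - m * N = \sum_(x in A) (q * (r x)%:R - N).
  by rewrite sumrB -mulr_sumr Ir sumr_const -[in RHS]mulr_natl.
apply: le_trans (sqr_sum_le _ _) _; rewrite -/m.
rewrite [q ^+ 4 * m]mulrC -mulrA ler_wpM2l ?ler0n //.
apply: (@le_trans _ _ (\sum_(x in [set: V]) (q * (r x)%:R - N) ^+ 2)).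
  rewrite [leRHS](big_setID A) /= setTI lerDl.
  by apply: sumr_ge0 => x _; apply: sqr_ge0.
under eq_bigr => x _.
  have -> : (q * (r x)%:R - N) ^+ 2
    = q ^+ 2 * (r x)%:R ^+ 2 - 2 * q * N * (r x)%:R + N ^+ 2 by ring.
  over.
rewrite big_split sumrB -!mulr_sumr r1 sumr_const -[_ *+ #|_|]mulr_natl cT /=.
(* The terms in q^3 N^2 have coefficients 1, -2 and 1 and cancel, leaving q^4 N. *)
have := ler_wpM2l (sqr_ge0 q) r2.
lra.
Qed.

(** * Planes with and without a line carrying more than half of their points *)

Definition line_rich A b : bool :=
  [exists p in setX (A :&: H b) (A :&: H b),
    (p.1 != p.2) && (#|A :&: H b| < 2 * #|A :&: line3 p.1 p.2|)%N].

Definition triples E : {set V * V * V} :=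
  [set u : V * V * V | [&& u.1.1 \in E, u.1.2 \in E :\ u.1.1
             & u.2 \in E :\: line3 u.1.1 u.1.2]].

(** With t points in the plane, there are t choices for x, then t - 1 for y, then at least t/2 for z
    off the line through x and y. *)
Lemma noncollinear_triples A b : ~~ line_rich A b -> (1 < #|A :&: H b|)%N ->
  (#|A :&: H b| ^ 3 <= 4 * #|triples (A :&: H b)|)%N.
Proof.
set E := A :&: H b; set t := #|E| => poor t1.
rewrite -sum1_card; under eq_bigl => u do rewrite inE andbA.
rewrite -(pair_big_dep
  (fun p : V * V => (p.1 \in E) && (p.2 \in E :\ p.1))
  (fun (p : V * V) z => z \in E :\: line3 p.1 p.2) (fun _ _ => 1%N)) /=.
rewrite -(pair_big_dep (fun x => x \in E) (fun x y => y \in E :\ x)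
  (fun x y => \sum_(z in E :\: line3 x y) 1)%N) /=.
have third x y : x \in E -> y \in E :\ x ->
    (t <= 2 * \sum_(z in E :\: line3 x y) 1)%N.
  move=> xE; rewrite in_setD1 => /andP[yx yE]; rewrite sum1_card.
  have le_t : (2 * #|A :&: line3 x y| <= t)%N.
    move: poor; rewrite negb_exists_in => /forall_inP /(_ (x, y)).
    by rewrite in_setX xE yE => /(_ isT) /=; rewrite eq_sym yx /= -leqNgt.
  have := cardsID (line3 x y) E; rewrite -/t.
   have : (#|E :&: line3 x y| <= #|A :&: line3 x y|)%N.
    by apply: subset_leq_card; apply: setSI; apply: subsetIl.
  lia.
have second x : x \in E ->
    ((t - 1) * t <= 2 * \sum_(y in E :\ x) \sum_(z in E :\: line3 x y) 1)%N.
  move=> xE; rewrite big_distrr /=.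
  have -> : (t - 1 = #|E :\ x|)%N by rewrite /t (cardsD1 x E) xE add1n subn1.
  by rewrite -sum_nat_const; apply: leq_sum => y; apply: third.
have first : (t * ((t - 1) * t) <= 2 *
    \sum_(x in E) \sum_(y in E :\ x) \sum_(z in E :\: line3 x y) 1)%N.
  by rewrite big_distrr /= -sum_nat_const; apply: leq_sum.
(* Since t >= 2, t <= 2 (t - 1), which turns t (t - 1) t <= 2 X into t^3 <= 4 X. *)
move: first; set X := (\sum_(x in E) _)%N; clear -t1 => first; nia.
Qed.

(** Two distinct planes through x and y meet exactly in their line, which z avoids; so each of the
    at most |A|^3 triples is counted for at most one plane. *)
Lemma sum_line_poor A D :
  (forall b, b \in D -> ~~ line_rich A b /\ (1 < #|A :&: H b|)%N) ->
  (\sum_(b in D) #|A :&: H b| ^ 3 <= 4 * #|A| ^ 3)%N.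
Proof.
move=> poor; pose G b := triples (A :&: H b).
pose A3 := setX (setX A A) A.
have A3G b : A3 :&: G b = G b.
  apply/setIidPr/subsetP => u; rewrite !inE.
  by move=> /and3P[/andP[-> _] /and3P[_ -> _] /and3P[_ -> _]].
apply: (@leq_trans (\sum_(b in D) 4 * #|A3 :&: G b|)).
  apply: leq_sum => b /poor[bp b1]; rewrite A3G.
  exact: noncollinear_triples.
rewrite -big_distrr /= leq_mul2l sum_cardsI /=.
have -> : (#|A| ^ 3 = \sum_(u in A3) 1)%N by rewrite sum1_card !cardsX; ring.
apply: leq_sum => u _; apply/card_le1_eqP => b b'.
rewrite !inE => /andP[_ /and3P[/andP[_ xb] /and3P[yx _ yb] /and3P[zl _ zb]]].
move=> /andP[_ /and3P[/andP[_ xb'] /and3P[_ _ yb'] /and3P[_ _ zb']]].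
apply/eqP; apply: contraNT zl => bb'; rewrite eq_sym in yx.
by rewrite -(hyperplane3_setI_line yx bb') !inE ?xb ?xb' ?yb ?yb' ?zb ?zb'.
Qed.

(** Distinct lines share at most one point, so the second moment gives J^2 <= m (J + |L|^2) with m =
    |A|. Richness gives T |L| <= 2 J, and then 8 m <= T^2 bounds m |L|^2 by J^2 / 2. *)
Lemma sum_rich_lines (R : realFieldType) (T : R) A (L : {set {set V}}) :
  0 <= T -> 8 * #|A|%:R <= T ^+ 2 ->
  (forall l, l \in L -> exists x y, x != y /\ l = line3 x y) ->
  (forall l, l \in L -> T <= 2 * #|A :&: l|%:R) ->
  (\sum_(l in L) #|A :&: l| <= 2 * #|A|)%N.
Proof.
move=> T0 T8 Lline LT; set J := (\sum_(l in L) #|A :&: l|)%N.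
have J2 : J%:R ^+ 2 <= #|A|%:R * (J%:R + #|L|%:R ^+ 2) :> R.
  rewrite {1}/J sum_cardsI natr_sum; apply: le_trans (sqr_sum_le _ _) _.
  rewrite ler_wpM2l ?ler0n //.
  under eq_bigr => x _ do rewrite -natrX.
  rewrite -natr_sum -natrX -natrD ler_nat -[(#|L| ^ 2)%N]mul1n.
  apply: sum_sqr_le => l l' lL l'L ll'; apply/card_le1_eqP => u v.
  rewrite !inE => /andP[/andP[_ ul] ul'] /andP[/andP[_ vl] vl'].
  apply/eqP; apply: contraNT ll' => uv.
  have [x [y [xy lE]]] := Lline _ lL; have [x' [y' [xy' lE']]] := Lline _ l'L.
  rewrite lE lE' in ul ul' vl vl' *.
  by rewrite -(line3_eq xy uv) // -(line3_eq xy' uv).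
have LJ : T * #|L|%:R <= 2 * J%:R.
  rewrite mulr_natr -sumr_const /J natr_sum mulr_sumr.
  by apply: ler_sum.
rewrite -(ler_nat R) natrM.
have LJ2 : (T * #|L|%:R) ^+ 2 <= (2 * J%:R) ^+ 2.
  by rewrite lerXn2r // nnegrE ?mulr_ge0 ?ler0n.
have L8 := ler_wpM2r (sqr_ge0 #|L|%:R) T8.
have JJ : J%:R * J%:R <= J%:R * (2 * #|A|%:R) :> R by nra.
have [J0|J0] := posnP J; first by rewrite J0 mulr_ge0 ?ler0n.
by move: JJ; rewrite ler_pM2l // ltr0n.
Qed.

Lemma sum_line_rich (R : realFieldType) (T : R) A D :
  0 <= T -> 8 * #|A|%:R <= T ^+ 2 ->
  (forall b, b \in D -> line_rich A b /\ T < #|A :&: H b|%:R) ->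
  (\sum_(b in D) #|A :&: H b| <= 4 * #|F| * #|A|)%N.
Proof.
move=> T0 T8 rich.
pose L := [set line3 p.1 p.2 | p in
  [set p : V * V | (p.1 != p.2) && (T <= 2 * #|A :&: line3 p.1 p.2|%:R)]].
have LP l : l \in L -> exists x y, x != y /\ l = line3 x y.
  by move=> /imsetP[[x y]]; rewrite inE => /andP[xy _] ->; exists x, y.
have LT l : l \in L -> T <= 2 * #|A :&: l|%:R.
  by move=> /imsetP[[x y]]; rewrite inE => /andP[_ h] ->.
have J := sum_rich_lines T0 T8 LP LT.
(* The line witnessing that [b] is rich lies in the plane and carries more than half of its more
   than T points, so it belongs to [L] and alone pays for the plane. Exchanging the sums then uses
   that a line lies in at most q planes. *)
apply: (@leq_trans (\sum_(b in D) \sum_(l in L | l \subset H b) 2 * #|A :&: l|)).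
  apply: leq_sum => b /rich[/exists_inP[[x y]]].
  rewrite in_setX /= => /andP[]; rewrite !(in_setI _ A) => /andP[_ xb] /andP[_ yb].
  move=> /andP[xy tl] Tb; rewrite (bigD1 (line3 x y)) /=.
    exact: leq_trans (ltnW tl) (leq_addr _ _).
  rewrite line3_sub_hyperplane // andbT; apply/imsetP; exists (x, y) => //.
  rewrite inE xy /= (le_trans (ltW Tb)) // -natrM ler_nat; exact: ltnW.
under eq_bigr => b _ do rewrite big_mkcondr.
rewrite exchange_big /=.
apply: (@leq_trans (\sum_(l in L) #|F| * (2 * #|A :&: l|))); last first.
  rewrite -!big_distrr /=.
  apply: leq_trans (leq_mul (leqnn _) (leq_mul (leqnn _) J)) _.
  by rewrite (mulnA 2) mulnCA mulnA.
apply: leq_sum => l lL; rewrite -big_mkcondr sum_nat_const leq_mul2r.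
have [x [y [xy ->]]] := LP _ lL; apply/orP; right.
apply: leq_trans (card_hyperplanes_through xy); apply: subset_leq_card.
apply/subsetP => b /andP[_ /subsetP lb]; rewrite in_set.
apply/andP; split; apply: lb; apply/imsetP.
  by exists 0; rewrite ?inE // scale0r addr0.
by exists 1; rewrite ?inE // scale1r addrC subrK.
Qed.

(** Everything is multiplied by T^2 to avoid division. A plane with t <= T points has t T^2 <= T^3,
    a larger line-poor one has t T^2 <= t^3, and the larger line-rich ones are summed directly. T >=
    2 ensures that larger planes have at least two points. *)
Lemma inc_rich (R : realFieldType) (T : R) A B :
  2 <= T -> 8 * #|A|%:R <= T ^+ 2 ->
  (inc A B)%:R * T ^+ 2 <= #|B|%:R * T ^+ 3 + 4 * #|A|%:R ^+ 3
     + 4 * #|F|%:R * #|A|%:R * T ^+ 2.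
Proof.
move=> T2 T8; have T0 : 0 <= T by lra.
pose t b : R := #|A :&: H b|%:R.
have -> : (inc A B)%:R = \sum_(b in B) t b by rewrite /inc natr_sum.
pose D1 := [set b in B | T < t b & ~~ line_rich A b].
pose D2 := [set b in B | T < t b & line_rich A b].
have S1 : \sum_(b in D1) t b ^+ 3 <= 4 * #|A|%:R ^+ 3.
  under eq_bigr => b _ do rewrite -natrX.
  rewrite -natr_sum -natrX -natrM ler_nat; apply: sum_line_poor => b.
  rewrite inE => /and3P[_ Tb ->]; split=> //.
  rewrite -(ltr_nat R); apply: le_lt_trans Tb; lra.
have S2 : \sum_(b in D2) t b <= 4 * #|F|%:R * #|A|%:R.
  rewrite -natr_sum -!natrM ler_nat; apply: (sum_line_rich T0 T8) => b.
  by rewrite inE => /and3P[].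
have -> : #|B|%:R * T ^+ 3 = \sum_(b in B) T ^+ 3 by rewrite sumr_const mulr_natl.
apply: (@le_trans _ _ (\sum_(b in B) T ^+ 3 + \sum_(b in D1) t b ^+ 3
    + (\sum_(b in D2) t b) * T ^+ 2)); last first.
  by apply: lerD; [exact: lerD | rewrite ler_wpM2r ?sqr_ge0].
under [X in _ + X + _]eq_bigl => b do rewrite inE.
rewrite [(\sum_(b in D2) _) * _]mulr_suml.
under [X in _ + _ + X]eq_bigl => b do rewrite inE.
rewrite mulr_suml !big_mkcondr -!big_split; apply: ler_sum => b _ /=.
have t0 : 0 <= t b by apply: ler0n.
have [tT|tT] := leP (t b) T.
  by rewrite /= !addr0 [leRHS]exprS ler_wpM2r ?sqr_ge0.
have T3 : 0 <= T ^+ 3 by apply: exprn_ge0.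
case: line_rich => /=; first by rewrite addr0 lerDr.
rewrite addr0 (le_trans (_ : _ <= t b ^+ 3)) ?lerDr //.
rewrite [t b ^+ 3]exprS ler_wpM2l // lerXn2r // ?nnegrE //; exact: ltW.
Qed.

End Incidences.

(** * The numerical bound, with a real parameter s for q^alpha *)

Lemma inc_bound (R : realFieldType) (F : finFieldType) (A B : {set 'rV[F]_3})
    (s : R) :
  1 <= s -> s <= #|F|%:R -> 0 \notin A \/ 0 \notin B ->
  2 * (#|F|%:R * s) <= #|B|%:R ->
  (inc A B)%:R <= 5 * (#|A|%:R * #|B|%:R / s + #|B|%:R * s ^+ 2).
Proof.
move=> s1 sq AB0; set q : R := #|F|%:R; set m : R := #|A|%:R.
set N : R := #|B|%:R; set I : R := (inc A B)%:R => NB.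
have m0 : 0 <= m by rewrite ler0n.
have s0 : 0 < s by lra.
have q0 : 0 < q by apply: lt_le_trans sq.
have qs0 : 0 < q * s by apply: mulr_gt0.
have N0 : 0 < N by lra.
(* With w = m/s and Y = w + s^2, the goal becomes I <= 5 Y N, and AM-GM reads 4 w s^2 <= Y^2. *)
set w := m / s; have w0 : 0 <= w by rewrite divr_ge0 // ltW.
have mE : m = w * s by rewrite /w divfK // gt_eqF.
have -> : m * N / s = w * N by rewrite /w mulrAC.
rewrite -[N * s ^+ 2]mulrC -mulrDl; set Y := w + s ^+ 2.
have s20 : 0 < s ^+ 2 by apply: exprn_gt0.
have Y0 : 0 < Y by rewrite /Y; lra.
have Ym : 4 * (w * s ^+ 2) <= Y ^+ 2.
  by rewrite /Y -subr_ge0; have := sqr_ge0 (w - s ^+ 2); nra.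
have [qs|qs] := leP q (s ^+ 2).
- have var : (q * I - m * N) ^+ 2 <= q ^+ 4 * m * N.
    (* The variance bound is symmetric in m and N, so whichever set avoids 0 can serve as the set of
       normals. *)
    case: AB0 => [A0|B0]; last exact: inc_variance.
    have := inc_variance R B A0; rewrite incC -/q -/I -/m -/N.
    by rewrite [N * m]mulrC mulrAC.
  (* From q <= s^2 and AM-GM, m q <= Y^2 s; the remaining factor q s is at most N/2. *)
  have NYY : m * N * q ^+ 2 <= (N * Y) ^+ 2.
    have : w * s * q <= Y ^+ 2 * s.
      apply: le_trans (_ : w * s * s ^+ 2 <= _).
        by rewrite ler_wpM2l // mulr_ge0 // ltW.
      rewrite mulrAC ler_wpM2r ?(ltW s0) //; nra.
    rewrite -mE => h.
    have : (m * q) * (N * q) <= (Y ^+ 2 * s) * (N * q).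
      by apply: ler_wpM2r => //; rewrite mulr_ge0 // ltW.
    have : (Y ^+ 2 * N) * (2 * (q * s)) <= (Y ^+ 2 * N) * N.
      by apply: ler_wpM2l => //; rewrite mulr_ge0 ?sqr_ge0 // ltW.
    have : 0 <= (Y ^+ 2 * N) * (q * s) by rewrite !mulr_ge0 ?sqr_ge0 // ltW.
    lra.
  have var2 : (q * I - m * N) ^+ 2 <= (q * (N * Y)) ^+ 2.
    apply: le_trans var _; rewrite exprMn.
    have := ler_wpM2l (sqr_ge0 q) NYY; lra.
  have var3 : q * I - m * N <= q * (N * Y).
    apply: le_trans (ler_norm _) _; rewrite -ler_sqr ?nnegrE ?real_normK ?num_real //.
    by rewrite !mulr_ge0 // ltW.
  have mN : m * N <= q * (N * Y).
    rewrite mE [w * s]mulrC -mulrA; apply: ler_pM => //; first exact: ltW.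
      by rewrite mulr_ge0 // ltW.
    by rewrite mulrC ler_wpM2l ?(ltW N0) // /Y lerDl ltW.
  rewrite -(ler_pM2l q0).
  have : 0 <= q * (N * Y) by rewrite !mulr_ge0 // ltW.
  lra.
- pose T := 2 * Y; have s21 : 1 <= s ^+ 2 by rewrite exprn_ege1.
  have T2 : 2 <= T by rewrite /T /Y; lra.
  have TT : T ^+ 2 = 4 * Y ^+ 2 by rewrite /T; ring.
  have Ts : 16 * (w * s ^+ 2) <= T ^+ 2 by rewrite TT; lra.
  have Tm : 16 * m <= T ^+ 2.
    apply: le_trans Ts; rewrite ler_pM2l // mE ler_wpM2l //; nra.
  have T8 : 8 * m <= T ^+ 2 by lra.
  have T20 : 0 < T ^+ 2 by rewrite exprn_gt0 //; lra.
  have := inc_rich B T2 T8; rewrite -/q -/m -/N -/I => main.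
  have w4 : 4 * w ^+ 2 <= T ^+ 2.
    rewrite TT ler_pM2l // lerXn2r // ?nnegrE // ?(ltW Y0) //.
    by rewrite /Y lerDl ltW.
  have ms : m * s ^+ 2 <= w * N.
    rewrite mE -mulrA; apply: ler_wpM2l => //.
    apply: le_trans NB; rewrite mulrC; have := ler_wpM2r (ltW s0) (ltW qs); lra.
  have qm : 2 * (q * m) <= w * N.
    rewrite mE; have := ler_wpM2l w0 NB; lra.
  (* Write m^3 = (m s^2) w^2, then use m s^2 <= w N and 4 w^2 <= T^2. *)
  have m3 : 4 * m ^+ 3 <= (w * N) * T ^+ 2.
    have h1 := ler_wpM2r (sqr_ge0 T) ms.
    have h2 : (m * s ^+ 2) * (4 * w ^+ 2) <= (m * s ^+ 2) * T ^+ 2.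
      by rewrite ler_wpM2l // mulr_ge0 // ltW.
    apply: le_trans h1; apply: le_trans h2.
    by rewrite le_eqVlt; apply/orP; left; apply/eqP; rewrite mE; ring.
  have qm2 : 4 * q * m * T ^+ 2 <= (2 * (w * N)) * T ^+ 2.
    by apply: ler_wpM2r; [exact: ltW | lra].
  (* The constant 5 arises here as 2 + 3, from Y >= w. *)
  have : I * T ^+ 2 <= (2 * Y * N + 3 * (w * N)) * T ^+ 2.
    apply: le_trans main _; have -> : N * T ^+ 3 = 2 * Y * N * T ^+ 2 by rewrite /T; ring.
    lra.
  rewrite ler_pM2r // => /le_trans -> //.
  have : 0 <= s ^+ 2 * N by rewrite mulr_ge0 // ltW.
  rewrite /Y; lra.
Qed.

(** * From sets of planes to sets of normals, and the theorem *)

Lemma incidencesE (F : finFieldType) (P : {set 'rV[F]_3})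
    (Pi : {set {set 'rV[F]_3}}) :
  incidences P Pi = (\sum_(E in Pi) #|P :&: E|)%N.
Proof.
rewrite (sum_cardsI P Pi id) /incidences -sum1_card.
under eq_bigl => u do rewrite !inE -andbA.
rewrite -(pair_big_dep (fun p => p \in P) (fun p E => (E \in Pi) && (p \in E))
  (fun _ _ => 1%N)) /=.
apply: eq_bigr => p _; rewrite -sum1_card.
by apply: eq_bigl => E; rewrite inE.
Qed.

Theorem theorem1p3 (R : realType) :
  exists C : R, 0 < C /\
    forall (q : nat) (F : finFieldType), #|F| = q ->
    forall (P : {set 'rV[F]_3}) (Pi : {set {set 'rV[F]_3}}),
    (forall pi, pi \in Pi ->
       is_plane pi /\ exists a : 'rV[F]_3, pi = hyperplane3 a 1) ->
    forall alpha : R, 0 < alpha -> alpha < 1 ->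
      (2 * q%:R `^ (1 + alpha) <= #|Pi|%:R ->
         (incidences P Pi)%:R <=
           C * (#|P|%:R * #|Pi|%:R / q%:R `^ alpha
                + #|Pi|%:R * q%:R `^ (2 * alpha)))
      /\
      (2 * q%:R `^ (1 + alpha) <= #|P|%:R ->
         (incidences P Pi)%:R <=
           C * (#|P|%:R * #|Pi|%:R / q%:R `^ alpha
                + #|P|%:R * q%:R `^ (2 * alpha))).
Proof.
exists 5; split=> // _ F <- P Pi planes alpha alpha0 alpha1.
pose B := [set a : 'rV[F]_3 | hyperplane3 a 1 \in Pi].
(* The normal 0 would give the empty set, whereas a genuine plane has a point. *)
have B0 : 0 \notin B.
  apply/negP; rewrite inE => /planes[[a [c [a0 E]]] _].
  have [w wc] := dot3_surj c a0.
  have : w \in hyperplane3 a c by rewrite inE wc.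
  by rewrite -E inE dot3E trmx0 mulmx0 mxE eq_sym oner_eq0.
have inj : {in B &, injective (fun a => hyperplane3 a 1)}.
  move=> a b aB _; apply: hyperplane3_inj.
  by apply: contraNneq B0 => <-.
have PiE : Pi = [set hyperplane3 a 1 | a in B].
  apply/setP => E; apply/idP/imsetP => [EPi|[a]]; last by rewrite inE => ? ->.
  have [_ [a Ea]] := planes _ EPi.
  by exists a => //; rewrite inE -Ea.
have cardPi : #|Pi| = #|B| by rewrite PiE card_in_imset.
have incE : incidences P Pi = inc P B.
  by rewrite incidencesE [in LHS]PiE big_imset.
have q1 : 1 <= #|F|%:R :> R by rewrite ler1n ltnW // card_finNzRing_gt1.
have q0 : #|F|%:R != 0 :> R by rewrite gt_eqF // (lt_le_trans ltr01).
set s := #|F|%:R `^ alpha.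
have s1 : 1 <= s by rewrite -(powRr0 #|F|%:R) ler_powR // ltW.
have sq : s <= #|F|%:R by rewrite ler1_powR // ltW.
have -> : #|F|%:R `^ (1 + alpha) = #|F|%:R * s.
  by rewrite powRD ?q0 ?implybT // powRr1 // (le_trans ler01).
have -> : #|F|%:R `^ (2 * alpha) = s ^+ 2.
  by rewrite mulrC powRrM powR_mulrn // powR_ge0.
rewrite incE cardPi; split=> [NB|NP].
  by apply: inc_bound => //; right.
(* For many points the roles are swapped: [P] acts as the large set of normals, possibly containing
   0, and [B] as the point set avoiding 0. *)
rewrite incC [_ * #|B|%:R]mulrC.
by apply: inc_bound => //; left.
Qed.
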